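(* Let $\mathcal{X}$ be a Banach space of analytic functions on $\mathbb{D}$ such that (i) $\mathcal{F}\subseteq\mathcal{X}$, and (ii) for every disk automorphism $\phi\in\mathrm{Aut}(\mathbb{D})$, the composition operator $C_\phi$ is bounded on $\mathcal{X}$ and $\rho(C_\phi)=1$. Let $\varphi\in\mathrm{Aut}(\mathbb{D})$ and let $C_\varphi$ be the induced composition operator on $\mathcal{X}$. Then $\sigma(C_\varphi)\subseteq\partial\mathbb{D}$.
   Context: $\mathbb{D}=\{z\in\mathbb{C}:|z|<1\}$ and $\partial\mathbb{D}$ is the unit circle. $\mathrm{Aut}(\mathbb{D})$ is the group of analytic bijections of $\mathbb{D}$, i.e. the maps $z\mapsto\lambda\frac{a-z}{1-\overline{a}z}$ with $|\lambda|=1$, $a\in\mathbb{D}$. A Banach space of analytic functions on $\mathbb{D}$ is a complex vector space of analytic functions $\mathbb{D}\to\mathbb{C}$ (with pointwise operations) that is complete under a given norm. For an analytic self-map $\varphi$ of $\mathbb{D}$, $C_\varphi f=f\circ\varphi$. For a bounded operator $T$ on $\mathcal{X}$, $\sigma(T)=\{\lambda\in\mathbb{C}:T-\lambda I\text{ is not invertible}\}$ and $\rho(T)=\sup\{|\lambda|:\lambda\in\sigma(T)\}$. The family $\mathcal{F}$ is the union of: the functions $f_s(z)=\exp\left(\frac{s(z+1)}{z-1}\right)$ for real $s\ge 0$; the functions $f_t(z)=\left(\frac{1+z}{1-z}\right)^{it}=\exp\left(it\log\frac{1+z}{1-z}\right)$ for $t\in\mathbb{R}$ ($\log$ the principal branch);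 and the monomials $z^k$ for $k\in\mathbb{N}=\{1,2,\dots\}$. *)

(* Defs.v *)
From HB Require Import structures.
From mathcomp Require Import all_boot all_order all_algebra.
From mathcomp Require Import all_classical all_reals all_analysis.
From mathcomp Require Import complex ring.

Set Implicit Arguments.
Unset Strict Implicit.
Unset Printing Implicit Defensive.

Import Order.TTheory GRing.Theory Num.Theory.
Import numFieldNormedType.Exports.

Local Open Scope classical_set_scope.
Local Open Scope ring_scope.
Local Open Scope complex_scope.

Definition disk (R : realType) : Type := {z : R[i] | `|z| < 1}.

(* [g] only serves to extend [f] to the complex plane: the difference quotient
   of [g] along the complex direction 1 at a point of the open disk involves
   only values of [f] near that point. *)
Definition analytic (R : realType) (f : disk R -> R[i]) : Prop :=
  exists g : R[i] -> R[i], forall z : disk R,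
    g (\val z) = f z /\ derivable (g : R[i]^o -> R[i]^o) (\val z) 1.

(* A vector space of functions on the disk is given as an abstract space
   [carrier] together with the injection [ev] sending each element to the
   function it is; [ev_linear] says that the operations are pointwise.  No
   relation between the norm and the values of the functions is assumed. *)
Record banachAnalytic (R : realType) := BanachAnalytic {
  carrier :> completeNormedModType R[i];
  ev : carrier -> disk R -> R[i];
  ev_inj : injective ev;
  ev_linear : forall (a : R[i]) (f g : carrier) (z : disk R),
    ev (a *: f + g) z = a * ev f z + ev g z;
  ev_analytic : forall f : carrier, analytic (ev f)
}.

Definition belongs (R : realType) (X : banachAnalytic R) : set (disk R -> R[i]) :=
  range (@ev R X).

(* The group Aut(D) in its explicit form; [disk_aut_exists], [disk_aut_inverse],
   [disk_aut_bijective] and [disk_aut_analytic] below check that every pair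
   (lambda, a) defines such a self-map, and that these maps are analytic
   bijections of the disk whose inverses are of the same form. *)
Definition disk_aut (R : realType) (phi : disk R -> disk R) : Prop :=
  exists (lambda a : R[i]), [/\ `|lambda| = 1, `|a| < 1 &
    forall z : disk R,
      \val (phi z) = lambda * ((a - \val z) / (1 - conjc a * \val z))].

Lemma derivable_mobius (K : numFieldType) (l a c z : K) : 1 - c * z != 0 ->
  derivable ((fun w => l * ((a - w) / (1 - c * w))) : K^o -> K^o) z 1.
Proof.
move=> d0.
have dnum : derivable ((fun w => a - w) : K^o -> K^o) z 1.
  by apply: derivableB; [exact: derivable_cst|exact: derivable_id].
have dden : derivable ((fun w => 1 - c * w) : K^o -> K^o) z 1.
  apply: derivableB; first exact: derivable_cst.
  by apply: (@derivableZ _ _ _ (id : K^o -> K^o) c); exact: derivable_id.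
have dinv := @derivableV K _ _ z 1 d0 dden.
have dq := @derivableM K _ _ _ z 1 dnum dinv.
exact: (@derivableZ _ _ _ _ l _ _ dq).
Qed.

Section DiskAut.
Variable R : realType.
Implicit Types (lambda a z : R[i]) (phi : disk R -> disk R).

Lemma mobius_den a z : `|a| < 1 -> `|z| < 1 -> 1 - conjc a * z != 0.
Proof.
move=> ha hz; rewrite subr_eq0; apply/negP => /eqP /(congr1 Num.norm) /eqP.
rewrite normr1 normrM normcJ eq_sym; apply/negP.
by rewrite lt_eqF// mulr_ilt1.
Qed.

Lemma mobius_lt1 lambda a z : `|lambda| = 1 -> `|a| < 1 -> `|z| < 1 ->
  `|lambda * ((a - z) / (1 - conjc a * z))| < 1.
Proof.
move=> hl ha hz; have d0 := mobius_den ha hz.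
rewrite normrM hl mul1r normrM normfV ltr_pdivrMr ?normr_gt0// mul1r.
rewrite -(@ltr_pXn2r _ 2) ?nnegrE// !sqr_normc -subr_gt0.
have -> : (1 - conjc a * z) * conjc (1 - conjc a * z) -
    (a - z) * conjc (a - z) = (1 - `|a| ^+ 2) * (1 - `|z| ^+ 2).
  rewrite !sqr_normc !rmorphB !rmorphM rmorph1 /= conjcK; ring.
by rewrite mulr_gt0// subr_gt0 expr_lt1.
Qed.

Lemma disk_aut_exists lambda a : `|lambda| = 1 -> `|a| < 1 ->
  exists phi, forall z : disk R,
    \val (phi z) = lambda * ((a - \val z) / (1 - conjc a * \val z)).
Proof.
move=> hl ha.
by exists (fun z : disk R => exist (fun w : R[i] => `|w| < 1) _ (mobius_lt1 hl ha (valP z))).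
Qed.

Lemma disk_aut_inverse phi : disk_aut phi ->
  exists2 psi, disk_aut psi & cancel phi psi /\ cancel psi phi.
Proof.
move=> [l [a [hl ha hphi]]].
have l1 : l * conjc l = 1 by rewrite -sqr_normc hl expr1n.
have hl' : `|conjc l| = 1 by rewrite normcJ.
have ha' : `|l * a| < 1 by rewrite normrM hl mul1r.
have [psi hpsi] := disk_aut_exists hl' ha'.
exists psi; first by exists (conjc l), (l * a).
have key x y (b m : R[i]) : `|b| < 1 -> m * conjc m = 1 -> `|x| < 1 -> 
  y = m * ((b - x) / (1 - conjc b * x)) -> `|y| < 1 ->
  conjc m * ((m * b - y) / (1 - conjc (m * b) * y)) = x.
  move=> hb m1 hx yE hy.
  have hmb : `|m * b| < 1.
    rewrite normrM; suff -> : `|m| = 1 by rewrite mul1r.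
    by apply/eqP; rewrite -(@eqrXn2 _ 2)// expr1n sqr_normc m1.
  have d1 := mobius_den hb hx; have d2 := mobius_den hmb hy.
  rewrite mulrA; apply: (mulIf d2); rewrite divfK//.
  apply: (mulIf d1); rewrite yE rmorphM /=.
  set c := conjc b in d1 *; set n := conjc m in m1 *.
  transitivity ((n * m) * (b * (1 - c * x) - (b - x))); first by field.
  transitivity (x * ((1 - c * x) - (m * n) * c * (b - x))); last by field.
  by rewrite m1 (mulrC n) m1; ring.
split=> z; apply: val_inj.
  by rewrite hpsi; exact: (key _ _ _ _ ha l1 (valP z) (hphi z) (valP (phi z))).
rewrite hphi.
have m1 : conjc l * conjc (conjc l) = 1 by rewrite conjcK mulrC.
have := key _ _ _ _ ha' m1 (valP z) (hpsi z) (valP (psi z)).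
have -> : conjc l * (l * a) = a by rewrite mulrA (mulrC (conjc l)) l1 mul1r.
by rewrite conjcK.
Qed.

Lemma disk_aut_bijective phi : disk_aut phi -> bijective phi.
Proof. by move=> /disk_aut_inverse[psi _ [? ?]]; exists psi. Qed.

Lemma disk_aut_analytic phi : disk_aut phi -> analytic (fun z : disk R => \val (phi z)).
Proof.
move=> [l [a [hl ha hphi]]].
exists (fun w => l * ((a - w) / (1 - conjc a * w))) => z; split=> //.
have d0 := mobius_den ha (valP z).
exact: (@derivable_mobius R[i] l a (conjc a) (\val z) d0).
Qed.

End DiskAut.

Definition composition_op (R : realType) (X : banachAnalytic R)
    (phi : disk R -> disk R) (T : {linear X -> X}) : Prop :=
  forall (f : X) (z : disk R), ev (T f) z = ev f (phi z).

Section Operators.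
Variables (R : realType) (X : normedModType R[i]).

Definition bounded_op (T : X -> X) : Prop :=
  exists M : R, forall f : X, `|T f| <= M%:C * `|f|.

Definition invertible_op (T : X -> X) : Prop :=
  exists S : {linear X -> X}, [/\ bounded_op S, cancel T S & cancel S T].

Definition spectrum (T : X -> X) : set R[i] :=
  [set lambda | ~ invertible_op (fun f => T f - lambda *: f)].

(* The norm of a complex number is itself an element of [R[i]], hence [Re]. *)
Definition spectral_radius (T : X -> X) : \bar R :=
  ereal_sup [set (complex.Re `|lambda|)%:E | lambda in spectrum T].

End Operators.

Section Family.
Variable R : realType.
Implicit Types z w : R[i].

Definition cexp z : R[i] :=
  (expR (complex.Re z))%:C * (cos (complex.Im z) +i* sin (complex.Im z)).

(* The principal argument, with values in ]-pi, pi] for w != 0. *)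
Definition Arg w : R :=
  let theta := acos (complex.Re w / complex.Re `|w|) in
  if 0 <= complex.Im w then theta else - theta.

Definition Log w : R[i] := ln (complex.Re `|w|) +i* Arg w.

Definition f_exp (s : R) (z : disk R) : R[i] :=
  cexp (s%:C * (\val z + 1) / (\val z - 1)).

Definition f_log (t : R) (z : disk R) : R[i] :=
  cexp ((0 +i* t) * Log ((1 + \val z) / (1 - \val z))).

Definition f_mon (k : nat) (z : disk R) : R[i] := \val z ^+ k.

Definition familyF : set (disk R -> R[i]) :=
  [set f_exp s | s in [set s | 0 <= s]] `|`
  range f_log `|`
  [set f_mon k | k in [set k | (0 < k)%N]].

End Family.

(* Main.v *)
(* The inverse of [C_phi] is the composition operator of the inverse
   automorphism, so both have spectral radius 1; inversion maps the spectrum of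
   [C_phi] into that of its inverse, which forces [|lambda| <= 1] and
   [|lambda^-1| <= 1]. *)
Require Import Defs.
From HB Require Import structures.
From mathcomp Require Import all_boot all_order all_algebra.
From mathcomp Require Import all_classical all_reals all_analysis.
From mathcomp Require Import complex.

Set Implicit Arguments.
Unset Strict Implicit.
Unset Printing Implicit Defensive.

Import Order.TTheory GRing.Theory Num.Theory.
Import numFieldNormedType.Exports.

Local Open Scope classical_set_scope.
Local Open Scope ring_scope.

Section Operators.
Variables (R : realType) (X : normedModType R[i]).

(* The bound is only assumed real, so it may be negative (when [X] is trivial),
   hence the absolute value. *)
Lemma bounded_op_comp (S T : X -> X) :
  bounded_op S -> bounded_op T -> bounded_op (S \o T).
Proof.
move=> [M hS] [N hT]; exists (`|M| * N) => f /=.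
rewrite (le_trans (hS _))// (@le_trans _ _ (`|M|%:C%C * `|T f|))//.
  by rewrite ler_wpM2r// lecR ler_norm.
by rewrite rmorphM /= -mulrA ler_wpM2l// (lecR 0) normr_ge0.
Qed.

Lemma bounded_op_scale (a : R[i]) (T : X -> X) :
  bounded_op T -> bounded_op (fun f => a *: T f).
Proof.
move=> [M hT]; exists (complex.Re `|a| * M) => f.
rewrite normrZ rmorphM /= -mulrA.
have -> : (complex.Re `|a|)%:C%C = `|a| by rewrite RRe_real ?normr_real.
by rewrite ler_wpM2l.
Qed.

(** The modulus is a real element of [R[i]], so taking [complex.Re] in the supremum loses
    nothing. *)
Lemma spectrum_le_radius (T : X -> X) (r : R) (lambda : R[i]) :
  spectral_radius T = r%:E -> spectrum T lambda -> `|lambda| <= r%:C%C.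
Proof.
move=> hr hl.
have : ((complex.Re `|lambda|)%:E <= spectral_radius T)%E.
  by apply: ereal_sup_ubound; exists lambda.
by rewrite hr lee_fin -lecR RRe_real ?normr_real.
Qed.

(** By contraposition: a bounded inverse [S] of [U - lambda^-1] gives the inverse [- lambda^-1 S U]
    of [T - lambda], bounded because [U] is. *)
Lemma spectrum_inverse (T U : {linear X -> X}) (lambda : R[i]) :
  bounded_op U -> cancel T U -> cancel U T -> spectrum T lambda ->
  lambda != 0 /\ spectrum U lambda^-1.
Proof.
move=> bU TK UK hl.
have l0 : lambda != 0.
  (* At 0 the operator is [T] itself, with bounded inverse [U]. *)
  apply/eqP => l0; apply: hl; exists U.
  by split=> // f; rewrite l0 scale0r subr0.
split=> // -[S [bS SK KS]]; apply: hl.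
(* [T - lambda = - lambda T (U - lambda^-1)] *)
exists (- lambda^-1 \*: (S \o U)); split=> [|f|f] /=.
- by apply: bounded_op_scale; exact: bounded_op_comp.
- rewrite -linearZ /= -[RHS]SK; congr (S _).
  rewrite [U (_ - _)]linearB /= TK linearZ /= scalerBr scalerA mulNr mulVf//.
  by rewrite scaleN1r opprK scaleNr addrC.
- rewrite linearZ /= scalerA mulrN mulfV// scaleN1r opprK.
  rewrite -[RHS]UK -[in RHS](KS (U f)) /=.
  by rewrite linearB linearZ /= UK scaleNr addrC.
Qed.

End Operators.

Theorem theorem3p2 (R : realType) (X : banachAnalytic R)
  (hF : @familyF R `<=` belongs X)
  (hAut : forall phi : disk R -> disk R, disk_aut phi ->
    exists T : {linear X -> X},
      [/\ composition_op phi T, bounded_op T &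
          spectral_radius T = 1%:E])
  (phi : disk R -> disk R) (hphi : disk_aut phi)
  (C_phi : {linear X -> X}) (hC : composition_op phi C_phi) :
  spectrum C_phi `<=` [set lambda : R[i] | `|lambda| = 1].
Proof.
have [psi hpsi [phiK psiK]] := disk_aut_inverse hphi.
have [T [hT _ rT]] := hAut _ hphi.
have [U [hU bU rU]] := hAut _ hpsi.
(* [hAut] only provides some operator inducing composition with [phi]; injectivity of [ev]
   identifies it with [C_phi], which thus has spectral radius 1. *)
have CT : C_phi = T :> (X -> X).
  by apply/funext => f; apply: ev_inj; apply/funext => z; rewrite hC hT.
(* Composition operators reverse order: [U (C_phi f)] is [f] composed with [phi \o psi], hence
   [psiK] here. *)
have TK : cancel C_phi U.
  by move=> f; apply: ev_inj; apply/funext => z; rewrite hU hC psiK.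
have UK : cancel U C_phi.
  by move=> f; apply: ev_inj; apply/funext => z; rewrite hC hU phiK.
move=> lambda hl /=.
have [l0 hl'] := spectrum_inverse bU TK UK hl.
apply/eqP; rewrite eq_le; apply/andP; split.
  by apply: (spectrum_le_radius (r := 1)) rT _; rewrite -CT.
rewrite -invf_le1 ?normr_gt0// -normfV.
exact: (spectrum_le_radius (r := 1)) rU hl'.
Qed.
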